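(* Let $D=(V(D),A(D),\chi)$ be a finite, simple, connected weighted digraph with vertex set $V(D)=\{v_1,\dots,v_n\}$, arc set $A(D)$ and weight function $\chi:V(D)\cup A(D)\to(0,\infty)$, and let $M(D)$ be its weighted middle digraph. Then $$\kappa^{vertex}(M(D),\chi)=\kappa^{edge}(D,\chi)\prod_{i=1}^{n}(\chi_i+d_i)^{r_i},$$ where, for $1\le i\le n$, $\chi_i=\chi(v_i)$, $r_i=d_-(v_i)$ is the number of arcs of $D$ with head $v_i$, and $d_i=\sum_{e\in A(D),\,t(e)=v_i}\chi(e)$ is the sum of the weights of the arcs of $D$ with tail $v_i$.
   Context: Digraphs are finite and simple (no loops, no parallel arcs; opposite arcs $(u,v)$ and $(v,u)$ may both be present). Connected means that the underlying undirected graph is connected. For an arc $e=(u,v)$, $t(e)=u$ is its tail and $h(e)=v$ its head. Spanning tree: a spanning tree of a digraph $D$ is a connected subdigraph containing all vertices of $D$ and having no cycles, in which one vertex (the root) has outdegree $0$ and every other vertex has outdegree $1$ (so arcs point towards the root). $\mathcal T(D)$ denotes the set of all spanning trees of $D$ (over all roots). Complexities: for a digraph with arc weights $\chi$, the edge weighted complexity is $\kappa^{edge}(D,\chi)=\sum_{T\in\mathcal T(D)}\prod_{e\in A(T)}\chi(e)$. For a digraph with vertex weights $\chi$, the vertex weighted complexity is $\kappa^{vertex}(D,\chi)=\sum_{T\in\mathcal T(D)}\prod_{e\in A(T)}\chi(h(e))$. Empty products equal $1$. Middle digraph: $M(D)$ is the digraph with vertex set $V(D)\cup A(D)$ (disjoint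 union) whose arcs are: $(v,e)$ for $v\in V(D)$, $e\in A(D)$ with $t(e)=v$; $(e,v)$ for $e\in A(D)$, $v\in V(D)$ with $h(e)=v$; and $(e,f)$ for $e,f\in A(D)$ with $h(e)=t(f)$. Its vertices are weighted by $\chi$: a vertex $v\in V(D)$ of $M(D)$ has weight $\chi(v)$ and a vertex $e\in A(D)$ of $M(D)$ has weight $\chi(e)$. *)

(* Defs.v *)
From HB Require Import structures.
From mathcomp Require Import all_boot all_order all_algebra.

Set Implicit Arguments.
Unset Strict Implicit.
Unset Printing Implicit Defensive.

Import Order.TTheory GRing.Theory Num.Theory.
Local Open Scope ring_scope.

(* An arc is a pair of distinct vertices, so parallel arcs are excluded while  *)
(* opposite arcs (u, v) and (v, u) may both be present.                        *)
Record digraph := Digraph {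
  vertex :> finType;
  arc : rel vertex;
  arc_irr : irreflexive arc
}.

Definition arcs (D : digraph) : finType := {p : D * D | arc p.1 p.2}.

Definition tail (D : digraph) (e : arcs D) : D := (val e).1.
Definition head (D : digraph) (e : arcs D) : D := (val e).2.

Definition undirected (V : finType) (r : rel V) : rel V :=
  [rel x y | r x y || r y x].

Definition weakly_connected (V : finType) (r : rel V) : bool :=
  [forall x, forall y, connect (undirected r) x y].

Definition connected (D : digraph) : bool := weakly_connected (@arc D).

(* [c] lists the distinct vertices of a cycle, either a directed one or one of *)
(* the underlying undirected graph. In the undirected case length 2 is         *)
(* excluded, as it would traverse a single arc back and forth; a pair of       *)
(* opposite arcs is a directed cycle of length 2.                              *)
Definition is_cycle (V : finType) (r : rel V) (c : seq V) : bool :=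
  uniq c && ((0 < size c)%N && cycle r c
             || (2 < size c)%N && cycle (undirected r) c).

(* The bound on the length only serves to make the predicate boolean: see      *)
(* [acyclicP].                                                                 *)
Definition acyclic (V : finType) (r : rel V) : bool :=
  [forall n : 'I_#|V|.+1, forall c : n.-tuple V, ~~ is_cycle r c].

Lemma acyclicP (V : finType) (r : rel V) :
  reflect (forall c : seq V, ~~ is_cycle r c) (acyclic r).
Proof.
apply: (iffP forallP) => [noc c | noc n]; last by apply/forallP => c.
apply/negP => cyc; have /andP[Uc _] := cyc.
have le_c : (size c < #|V|.+1)%N.
  by rewrite ltnS -(card_uniqP Uc) max_card.
by have /forallP/(_ (in_tuple c)) := noc (Ordinal le_c); rewrite cyc.
Qed.

(* A set of arcs stands for the subdigraph that has these arcs and contains    *)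
(* all the vertices of [D]; [sub_arc T] is its arc relation.                   *)
Definition sub_arc (D : digraph) (T : {set arcs D}) : rel D :=
  [rel x y | [exists e in T, (tail e == x) && (head e == y)]].

Definition outdeg (D : digraph) (T : {set arcs D}) (v : D) : nat :=
  #|[set e in T | tail e == v]|.

Definition indeg (D : digraph) (v : D) : nat := #|[set e : arcs D | head e == v]|.

Definition is_rooted (D : digraph) (T : {set arcs D}) : bool :=
  [exists root : D, (outdeg T root == 0)%N
                    && [forall (v | v != root), (outdeg T v == 1)%N]].

Definition spanning_trees (D : digraph) : {set {set arcs D}} :=
  [set T | [&& weakly_connected (sub_arc T), acyclic (sub_arc T) & is_rooted T]].

Definition kappa_edge (R : realFieldType) (D : digraph) (chi : arcs D -> R) : R :=
  \sum_(T in spanning_trees D) \prod_(e in T) chi e.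

Definition kappa_vertex (R : realFieldType) (D : digraph) (chi : D -> R) : R :=
  \sum_(T in spanning_trees D) \prod_(e in T) chi (head e).

Definition middle_arc (D : digraph) : rel (D + arcs D) := fun x y =>
  match x, y with
  | inl _, inl _ => false
  | inl v, inr e => tail e == v
  | inr e, inl v => head e == v
  | inr e, inr f => head e == tail f
  end.

Lemma middle_arc_irr (D : digraph) : irreflexive (@middle_arc D).
Proof.
case=> //= -[[u v] /= uv]; rewrite /head /tail /=.
by apply/eqP => vu; rewrite vu arc_irr in uv.
Qed.

Definition middle_digraph (D : digraph) : digraph :=
  Digraph (@middle_arc_irr D).

Definition out_weight (R : realFieldType) (D : digraph) (chi : arcs D -> R)
    (v : D) : R :=
  \sum_(e : arcs D | tail e == v) chi e.

(* Main.v *)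
(* The determinant of x + L, L the Laplacian of a weighted digraph, expands   *)
(* by multilinearity in the rows as a sum over the maps that send each vertex *)
(* either to one of its out-arcs or to an extra sink, at cost x. Each map     *)
(* contributes its weight times det (1 - A), with A the matrix of the map;    *)
(* this is 1 if all iterates reach the sink and 0 otherwise. Hence the        *)
(* coefficient of x is the sum over spanning trees, over all roots at once.   *)
(* In the middle digraph, the row of an arc e is obtained from that of h(e) by *)
(* adding a jump to h(e). The Laplacian is therefore similar to a block       *)
(* triangular matrix whose diagonal blocks are the Laplacian of D and the     *)
(* diagonal matrix with entry chi_i + d_i at each arc with head v_i.          *)
From Pilot Require Import Defs.
From HB Require Import structures.
From mathcomp Require Import all_boot all_order all_fingroup all_algebra.

Set Implicit Arguments.
Unset Strict Implicit.
Unset Printing Implicit Defensive.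

Import Order.TTheory GRing.Theory Num.Theory.
(* [head] must denote the head of an arc, not [seq.head]. *)
Import Pilot.Defs.
Local Open Scope ring_scope.

(** Both complexities are read off as the coefficient of ['X] in a determinant ([kappa_edge_coef]):
    in the expansion [det_laplacian], a forest with k roots contributes to degree k only, and the
    forests with one root are the spanning trees. The vertex weighted complexity is the edge
    weighted one for the weight of the head of an arc. [det_laplacian_middle] factors the
    determinant of the middle digraph as that of [D] times the product over arcs e of x + chi_i +
    d_i, with v_i the head of e. If [D] has a vertex, its determinant has no constant term, so the
    coefficient of x is [kappa_edge] times that product at x = 0; grouping arcs by head yields the
    exponents r_i. *)

(** * Partial maps whose iterates all reach the sink *)

(* [None] is the extra sink, to which the roots are sent.                     *)
Definition is_forest (V : finType) (f : V -> option V) : bool :=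
  [forall v, fconnect (obind f) (Some v) None].

Lemma is_forestP (V : finType) (f : V -> option V) :
  reflect (forall v, exists n, iter n (obind f) (Some v) = None) (is_forest f).
Proof.
apply: (iffP forallP) => F v; last by have [n <-] := F v; apply: fconnect_iter.
by exists (findex (obind f) (Some v) None); apply: iter_findex.
Qed.

(** The height is the least number of steps to [None]. It serves as a potential that rules out
    cycles. *)
Lemma forest_height (V : finType) (f : V -> option V) : is_forest f ->
  exists h : V -> nat, forall v u, f v = Some u -> (h u < h v)%N.
Proof.
move=> /is_forestP F.
have F' v : exists n, iter n (obind f) (Some v) == None.
  by have [n /eqP ?] := F v; exists n.
exists (fun v => ex_minn (F' v)) => v u fv.
case: (ex_minnP (F' u)) => m _ minm; case: (ex_minnP (F' v)) => -[|n] //.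
by rewrite iterSr /= fv => itn _; rewrite ltnS minm.
Qed.

Lemma forest_iter_succ (V : finType) (f : V -> option V) (s : V -> V) v :
  is_forest f -> (forall n, f (iter n s v) = Some (iter n.+1 s v)) -> False.
Proof.
move=> /is_forestP/(_ v)[n itn] fs.
have: iter n (obind f) (Some v) = Some (iter n s v).
  by elim: n {itn} => //= n ->; rewrite /= fs.
by rewrite itn.
Qed.

Definition step_mx (R : nzRingType) (V : finType) n (g : 'I_n -> V)
    (f : V -> option V) : 'M[R]_n :=
  \matrix_(i, j) ((i == j)%:R - (f (g i) == Some (g j))%:R).

(** In a forest only the identity permutation contributes: a nonzero term of another one would
    follow [f] forever from a moved point. Otherwise the vertices that never reach [None] give a
    kernel vector. *)
Lemma det_step_mx (R : idomainType) (V : finType) n (g : 'I_n -> V)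
    (f : V -> option V) : bijective g ->
  \det (step_mx R g f) = (is_forest f)%:R.
Proof.
move=> [g' gK g'K]; case: (boolP (is_forest f)) => [forf | /forallPn[v vN]].
  rewrite /determinant (bigD1 (1%g : {perm _})) //= odd_perm1 mul1r.
  rewrite [X in _ + X]big1 ?addr0 => [|s s1].
    apply: big1 => i _; rewrite mxE perm1 eqxx.
    case: eqP => [fi|]; rewrite ?subr0 //.
    case: (@forest_iter_succ _ f id (g i) forf) => k.
    by rewrite !iter_fix.
  have [i si] : exists i, s i != i.
    apply/existsP; rewrite -negb_forall; apply: contra s1 => /forallP s1.
    by apply/eqP/permP => i; rewrite perm1; apply/eqP.
  have si_neq k : s (iter k s i) != iter k s i.
    by elim: k => // k; rewrite /= (inj_eq perm_inj).
  apply/eqP; rewrite mulf_eq0; apply/orP; right; apply/prodf_eq0.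
  apply/exists_inP; apply: contraT; rewrite negb_exists_in => /forall_inP nz.
  case: (@forest_iter_succ _ f (fun v => g (s (g' v))) (g i) forf) => k.
  have itE m : iter m (fun v => g (s (g' v))) (g i) = g (iter m s i).
    by elim: m => //= m ->; rewrite gK.
  have := nz (iter k s i) isT; rewrite !itE mxE [iter k s i == _]eq_sym.
  rewrite (negPf (si_neq k)) sub0r oppr_eq0.
  by case: (f _ =P Some _) => // _; rewrite eqxx.
pose u := \col_i (~~ fconnect (obind f) (Some (g i)) None)%:R : 'cV[R]_n.
apply/eqP; rewrite -det_tr; apply/det0P; exists u^T.
  apply/eqP => /matrixP/(_ 0 (g' v)); rewrite !mxE g'K vN.
  by move/eqP; rewrite oner_eq0.
rewrite -trmx_mul; apply/matrixP => i j; rewrite !mxE.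
under eq_bigr => k _ do rewrite mxE [u _ _]mxE mulrBl.
rewrite sumrB (bigD1 j) //= eqxx mul1r big1 ?addr0 => [|k]; last first.
  by rewrite eq_sym => /negPf->; rewrite mul0r.
(* A vertex reaches the sink exactly when its image does, so [u] takes the same value at both. *)
have -> : fconnect (obind f) (Some (g j)) None =
          fconnect (obind f) (f (g j)) None.
  apply/idP/idP => [c | ]; last first.
    by apply: connect_trans; apply: (fconnect1 (obind f) (Some (g j))).
  have := iter_findex c; case: findex => // m; rewrite iterSr /= => <-.
  exact: fconnect_iter.
case fj: (f (g j)) => [y|].
  rewrite (bigD1 (g' y)) //= g'K eqxx mul1r big1 ?addr0 ?subrr // => k.
  by case: (Some y =P Some (g k)) => [[->]|_ _]; rewrite ?gK ?eqxx ?mul0r.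
by rewrite connect0 big1 ?subr0 // => k _; rewrite mul0r.
Qed.

(** * Forest expansion of the Laplacian determinant *)

Lemma sumr_option (M : nmodType) (I : finType) (P : pred (option I))
    (F : option I -> M) :
  \sum_(o | P o) F o =
  (if P None then F None else 0) + \sum_(i | P (Some i)) F (Some i).
Proof.
rewrite big_mkcond (bigD1 None) //=; congr (_ + _).
rewrite -big_mkcondr (reindex_omap Some id) //=; last by case.
by apply: eq_bigl => i; rewrite eqxx andbT.
Qed.

Section ForestTheorem.
Variables (R : idomainType) (D : digraph) (w : arcs D -> R) (x : R).

Definition laplacian n (g : 'I_n -> D) : 'M[R]_n :=
  \matrix_(i, j) ((x + \sum_(e | tail e == g i) w e) *+ (i == j)
                  - \sum_(e | (tail e == g i) && (head e == g j)) w e).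

Definition out_choice : {pred {ffun D -> option (arcs D)}} :=
  [pred p in family (fun v o => if o is Some e then tail e == v else true)].

Definition next (p : {ffun D -> option (arcs D)}) (v : D) : option D :=
  omap (@head D) (p v).

(** Row v is the sum, over the options at v, of the weight of the option times a row of [step_mx];
    multilinearity then gives one [step_mx] determinant per choice function. *)
Lemma det_laplacian n (g : 'I_n -> D) : bijective g ->
  \det (laplacian g) =
  \sum_(p in out_choice | is_forest (next p)) \prod_v oapp w x (p v).
Proof.
move=> bg; have [g' gK g'K] := bg.
pose r v (o : option (arcs D)) j : R :=
  (v == g j)%:R - (omap (@head D) o == Some (g j))%:R.
have lapE i j : laplacian g i j =
    \sum_(o | if o is Some e then tail e == g i else true)
      oapp w x o * r (g i) o j.
  rewrite mxE sumr_option /= /r /= subr0 -(mulr_natr (x + _)) mulrDl -addrA.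
  rewrite (inj_eq (bij_inj bg)); congr (_ + _).
  rewrite mulr_suml [X in _ - X]big_mkcondr -sumrB /=.
  apply: eq_bigr => e _; rewrite mulrBr; congr (_ - _).
  rewrite (inj_eq Some_inj).
  by case: (head e == _); rewrite ?mulr1 ?mulr0.
transitivity (\sum_(p in out_choice) (\prod_v oapp w x (p v)) *
               \det (step_mx R g (next p))).
  rewrite /determinant; under [RHS]eq_bigr => p _ do rewrite mulr_sumr.
  rewrite exchange_big /=; apply: eq_bigr => s _.
  under [X in _ * X]eq_bigr => i _ do rewrite lapE.
  have -> : \prod_i \sum_(o | if o is Some e then tail e == g i else true)
             oapp w x o * r (g i) o (s i) =
     \prod_v \sum_(o | if o is Some e then tail e == v else true)
             oapp w x o * r v o (s (g' v)).
    rewrite [RHS](reindex g) /=; last exact: onW_bij.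
    by apply: eq_bigr => i _; rewrite gK.
  rewrite bigA_distr_big_dep mulr_sumr; apply: eq_bigr => p _.
  rewrite mulrCA big_split /=; congr (_ * (_ * _)).
  rewrite (reindex g) /=; last exact: onW_bij.
  by apply: eq_bigr => i _; rewrite gK mxE /r (bij_eq bg).
rewrite [RHS]big_mkcondr; apply: eq_bigr => p _.
by rewrite (det_step_mx _ _ bg); case: is_forest; rewrite ?mulr1 ?mulr0.
Qed.
End ForestTheorem.

Arguments out_choice {D}.

(** * Spanning trees as forests with a single root *)

Section SpanningTrees.
Variable D : digraph.
Implicit Types (p : {ffun D -> option (arcs D)}) (T : {set arcs D}).

Definition arc_set p : {set arcs D} := [set e | p (tail e) == Some e].

Definition out_fun T : {ffun D -> option (arcs D)} :=
  [ffun v => [pick e in T | tail e == v]].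

Definition roots p : {set D} := [set v | p v == None].

Lemma out_choiceP p v e : p \in out_choice -> p v = Some e -> tail e = v.
Proof. by move=> /familyP/(_ v) pv pve; move: pv; rewrite pve => /eqP. Qed.

Lemma arc_setK p : (out_fun (arc_set p) == p) = (p \in out_choice).
Proof.
apply/eqP/idP => [<- | pP].
  apply/familyP => v; rewrite ffunE.
  by case: pickP => // e /andP[_ /eqP<-]; rewrite unfold_in eqxx.
apply/ffunP => v; rewrite ffunE; case: pickP => [e | noe].
  by rewrite inE => /andP[/eqP pe /eqP <-].
case pv: (p v) => [e|] //; have := noe e.
by rewrite inE (out_choiceP pP pv) pv !eqxx.
Qed.

Lemma out_funK T : is_rooted T -> arc_set (out_fun T) = T.
Proof.
move=> /existsP[r /andP[/eqP r0 /forall_inP nr1]].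
apply/setP => e; rewrite inE ffunE; case: pickP => [e' | noe].
  move=> /andP[e'T /eqP tl]; apply/eqP/idP => [[<-] // | eT].
  have: (outdeg T (tail e) <= 1)%N.
    by have [->|/nr1/eqP->] := eqVneq (tail e) r; rewrite ?r0.
  by move/card_le1_eqP => H; rewrite (H e' e) // inE ?e'T ?eT ?tl eqxx.
by apply/esym/negbTE/negP => eT; have := noe e; rewrite eT eqxx.
Qed.

Lemma sub_arc_arc_set p x y : p \in out_choice ->
  sub_arc (arc_set p) x y = (next p x == Some y).
Proof.
move=> pP; rewrite /sub_arc /next /=; apply/exists_inP/eqP => [[e] | ].
  by rewrite inE => /eqP pe /andP[/eqP<- /eqP<-]; rewrite pe.
case px: (p x) => [e|] //= [<-].
exists e; rewrite ?inE (out_choiceP pP px) ?px //.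
by rewrite !eqxx.
Qed.

Lemma outdeg_arc_set p v : p \in out_choice ->
  outdeg (arc_set p) v = (p v != None).
Proof.
move=> pP; rewrite /outdeg; case pv: (p v) => [e|] /=.
  rewrite (_ : [set _ in _ | _] = [set e]) ?cards1 //.
  apply/setP => e'; rewrite !inE; apply/andP/eqP => [[/eqP + /eqP te]|->].
    by rewrite te pv => -[].
  by rewrite (out_choiceP pP pv) pv !eqxx.
apply/eqP; rewrite cards_eq0; apply/eqP/setP => e'; rewrite !inE.
by apply/negbTE/negP => /andP[/eqP + /eqP te]; rewrite te pv.
Qed.

Lemma is_rooted_arc_set p : p \in out_choice ->
  is_rooted (arc_set p) = (#|roots p| == 1%N).
Proof.
move=> pP; apply/existsP/cards1P => -[r].
  move=> /andP[]; rewrite outdeg_arc_set // eqb0 negbK => r0 /forall_inP nr.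
  exists r; apply/setP => v; rewrite !inE.
  have [->|/nr] := eqVneq v r; first exact: r0.
  by rewrite outdeg_arc_set // eqb1 => /negPf.
move/setP => rE; exists r; rewrite outdeg_arc_set //.
have := rE r; rewrite !inE eqxx => ->; apply/forall_inP => v.
by rewrite outdeg_arc_set // eqb1; have := rE v; rewrite !inE => ->.
Qed.

(** A vertex that never reaches [None] has an infinite orbit in a finite set, which closes up into a
    directed cycle. *)
Lemma acyclic_forest p : p \in out_choice ->
  acyclic (sub_arc (arc_set p)) -> is_forest (next p).
Proof.
move=> pP /acyclicP noc; apply/forallP => v; apply: contraT => vN.
(* The default is never taken along the orbit of [v], by [itS]. *)
pose g u := odflt u (next p u).
have itN k : ~~ fconnect (obind (next p)) (Some (iter k g v)) None.
  elim: k => //= k; apply: contra; rewrite {1}/g.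
  case E: (next p _) => [u|] //= c; apply: connect_trans c.
  by rewrite -E; apply: (fconnect1 (obind (next p)) (Some _)).
have itS k : next p (iter k g v) = Some (g (iter k g v)).
  have := itN k; rewrite /g; case E: (next p _) => //= /negP[].
  by rewrite -E; apply: (fconnect1 (obind (next p)) (Some _)).
(* The orbit first returns to its i-th point; the points from there on form a cycle of length
   [k.+1]. *)
have /trajectP[i lti itE] := looping_order g v.
case ki: (fingraph.order g v - i)%N (subn_gt0 i (fingraph.order g v)) => [|k].
  by rewrite lti.
move=> _; apply: contraNT (noc (traject g (iter i g v) k.+1)) => _.
apply/andP; split.
  have := orbit_uniq g v; rewrite /fingraph.orbit -(subnKC (ltnW lti)).
  by rewrite ki trajectD cat_uniq => /and3P[].
apply/orP; left; rewrite size_traject andTb.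
apply: (@sub_in_cycle _ (fun u => next p u == Some (g u)) (frel g)).
- by move=> x y /eqP px _ /= /eqP<-; rewrite sub_arc_arc_set // px.
- apply/allP => u /trajectP[m _ ->]; rewrite -iterD; exact/eqP.
have gy : iter k g (g (iter i g v)) = iter i g v.
  by rewrite -iterSr -iterD -ki subnK // ltnW.
by rewrite /= -[X in rcons _ X]gy -trajectSr fpath_traject.
Qed.

(** Arcs lower the height, so both cycle arcs at a highest vertex x leave x. As x has one out-arc,
    its two neighbours coincide, which is impossible in an undirected cycle of length over 2. A
    directed cycle would have to enter x. *)
Lemma forest_acyclic p : p \in out_choice ->
  is_forest (next p) -> acyclic (sub_arc (arc_set p)).
Proof.
move=> pP /forest_height[h hP]; apply/acyclicP => c; apply/negP.
move=> /andP[Uc cyc].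
have hsub x y : sub_arc (arc_set p) x y -> (h y < h x)%N.
  by rewrite sub_arc_arc_set // => /eqP; apply: hP.
have [v cv]: exists v, v \in c.
  by case: c cyc {Uc} => //= v c _; exists v; rewrite inE eqxx.
have [x cx xmax] := @arg_maxnP D v (fun u => u \in c) h cv.
have [i s cE] := rot_to cx.
have sle y : y \in s -> (h y <= h x)%N.
  by move=> ys; apply: xmax; rewrite -(mem_rot i) cE inE ys orbT.
move: Uc cyc; rewrite -(rot_uniq i) -(size_rot i).
rewrite -(rot_cycle i (sub_arc _)) -(rot_cycle i (undirected _)) cE.
case/lastP: s sle {cE} => [_ _ | s z sle] /=.
  by rewrite ?andbT ?orbF => /hsub; rewrite ltnn.
rewrite !rcons_path last_rcons.
have hz : (h z <= h x)%N by apply: sle; rewrite mem_rcons inE eqxx.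
have zx : sub_arc (arc_set p) z x = false.
  by apply/negbTE/negP => /hsub; rewrite ltnNge hz.
rewrite zx !andbF orFb => Us /and3P[sz /andP[path_s _] xz].
case: s sz Us path_s sle => //= y s _ /andP[_ /andP[ys _]] /andP[xy _] sle.
have yx : sub_arc (arc_set p) y x = false.
  by apply/negbTE/negP => /hsub; rewrite ltnNge sle // inE eqxx.
move: xy xz; rewrite /undirected /= yx zx orbF !sub_arc_arc_set //.
by move=> /eqP-> /eqP[yz]; rewrite yz mem_rcons inE eqxx in ys.
Qed.

(** Every vertex is joined by its forward path to a root, and there is only one root. *)
Lemma forest_connected p : p \in out_choice -> (#|roots p| <= 1)%N ->
  is_forest (next p) -> weakly_connected (sub_arc (arc_set p)).
Proof.
move=> pP /card_le1_eqP rt1 /is_forestP forp.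
have mem_roots v : next p v = None -> v \in roots p.
  by rewrite inE /next; case: (p v).
have rt v u : next p v = None -> next p u = None -> v = u.
  by move=> /mem_roots pv /mem_roots pu; apply: rt1.
have csym : connect_sym (undirected (sub_arc (arc_set p))).
  by apply: sym_connect_sym => a b; apply: orbC.
have to_root r v : next p r = None ->
    connect (undirected (sub_arc (arc_set p))) v r.
  move=> pr; have [n] := forp v; elim: n v => // n IH v.
  rewrite iterSr /=; case pv: (next p v) => [u|] itn; last by rewrite (rt v r).
  apply: connect_trans (IH u itn); apply: connect1.
  by apply/orP; left; rewrite sub_arc_arc_set // pv.
have ex_root (v : D) : exists r, next p r = None.
  have [n] := forp v; elim: n v => // n IH v; rewrite iterSr /=.
  by case pv: (next p v) => [u|]; [apply: IH | exists v].
apply/forallP => v; apply/forallP => u; have [r pr] := ex_root v.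
by apply: connect_trans (to_root r v pr) _; rewrite csym to_root.
Qed.

Lemma spanning_trees_arc_set p : p \in out_choice ->
  (arc_set p \in spanning_trees D) =
  is_forest (next p) && (#|roots p| == 1%N).
Proof.
move=> pP; rewrite inE is_rooted_arc_set //.
apply/and3P/andP => [[_ ac ->] | [forp rt1]].
  by rewrite (acyclic_forest pP ac).
by rewrite forest_connected ?forest_acyclic // (eqP rt1).
Qed.

End SpanningTrees.

(** * Low coefficients of the Laplacian determinant *)

Section KappaCoef.
Variables (R : realFieldType) (D : digraph) (w : arcs D -> R).

Lemma prod_out_choice p : p \in out_choice ->
  \prod_v oapp (polyC \o w) 'X (p v) =
  'X^#|roots p| * (\prod_(e in arc_set p) w e)%:P.
Proof.
move=> pP; rewrite (bigID (mem (roots p))) /=; congr (_ * _).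
  rewrite -prodr_const; apply: eq_bigr => v; rewrite inE => /eqP-> //.
rewrite (reindex_omap (@tail D) p) /= => [|v]; last first.
  by rewrite inE; case pv: (p v) => [e|] //= _; rewrite (out_choiceP pP pv).
rewrite rmorph_prod /=; apply: eq_big => [e|e /andP[_ /eqP->] //].
by rewrite !inE; case: (p (tail e)).
Qed.

Lemma kappa_edge_coef n (g : 'I_n -> D) : bijective g ->
  kappa_edge w = (\det (laplacian (polyC \o w) 'X g))`_1.
Proof.
move=> bg; rewrite (det_laplacian _ _ bg) coef_sum /kappa_edge.
rewrite (reindex_onto (@arc_set D) (@out_fun D)) /=; last first.
  by move=> T; rewrite inE => /and3P[_ _ /out_funK].
rewrite (eq_bigl (fun p => (p \in out_choice) && is_forest (next p)
                           && (#|roots p| == 1%N))); last first.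
  move=> p; rewrite arc_setK andbC; case: (boolP (p \in out_choice)) => // pP.
  by rewrite spanning_trees_arc_set.
rewrite big_mkcondr; apply: eq_bigr => p /andP[pP forp].
rewrite prod_out_choice // coefXnM coefC.
by case: #|roots p| => [|[|k]] //=.
Qed.

(** A forest on a nonempty vertex set has a root, hence a factor ['X]. The vertex [v] excludes the
    empty digraph, whose determinant is 1. *)
Lemma coef0_det_laplacian n (g : 'I_n -> D) (v : D) : bijective g ->
  (\det (laplacian (polyC \o w) 'X g))`_0 = 0.
Proof.
move=> bg; rewrite (det_laplacian _ _ bg) coef_sum.
apply: big1 => p /andP[pP forp]; rewrite prod_out_choice // coefXnM.
case: ltnP => //; rewrite leqn0 cards_eq0 => /eqP/setP no_root.
case: (@forest_iter_succ _ (next p) (fun u => odflt u (next p u)) v forp) => k.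
have := no_root (iter k (fun u => odflt u (next p u)) v).
by rewrite !inE /= /next; case: (p _).
Qed.
End KappaCoef.

(** * The Laplacian of the middle digraph *)

Lemma sum_arcs_tail (M : nmodType) (D : digraph) (x : D) (P : pred D)
    (F : D -> M) :
  \sum_(a : arcs D | (tail a == x) && P (head a)) F (head a) =
  \sum_(y | arc x y && P y) F y.
Proof.
rewrite [RHS](reindex_omap (@head D) (fun y => insub (x, y))) /=; last first.
  by move=> y /andP[xy _]; rewrite insubT.
apply: eq_bigl => a; rewrite andbAC; congr (_ && _).
apply/eqP/andP => [<-|[_ /eqP]].
  rewrite /tail /head -surjective_pairing valK eqxx; split=> //.
  exact: (valP a).
by case: insubP => //= b _ bE [<-]; rewrite (congr1 fst bE : tail b = x).
Qed.

Lemma sum_arc_between (M : nmodType) (D : digraph) (x y : D) (F : D -> M) :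
  \sum_(a : arcs D | (tail a == x) && (head a == y)) F (head a) =
  if arc x y then F y else 0.
Proof.
by rewrite (sum_arcs_tail x (pred1 y)) big_mkcondl (big_pred1 y).
Qed.

Section Middle.
Variables (R : realFieldType) (D : digraph) (chi : D + arcs D -> R).

Let chiA (e : arcs D) : R := chi (inr e).
Let W (v : D) : R := chi (inl v) + out_weight chiA v.

Definition sum_enum (i : 'I_(#|D| + #|arcs D|)) : middle_digraph D :=
  match split i with
  | inl j => inl (enum_val j)
  | inr k => inr (enum_val k)
  end.

Lemma sum_enum_bij : bijective sum_enum.
Proof.
exists (fun x : D + arcs D => match x with
  | inl v => lshift _ (enum_rank v) | inr e => rshift _ (enum_rank e) end).
  move=> i; rewrite /sum_enum; case: splitP => j ij; apply/val_inj;
  by rewrite /= enum_valK ij.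
case=> a; rewrite /sum_enum.
  by rewrite (unsplitK (inl _)) enum_rankK.
by rewrite (unsplitK (inr _)) enum_rankK.
Qed.

(** [tail_mx *m head_mx] is the weighted adjacency matrix of [D]; the product in the other order is
    that of consecutive arcs. *)
Definition head_mx : 'M[{poly R}]_(#|arcs D|, #|D|) :=
  \matrix_(k, i) (head (enum_val k) == enum_val i)%:R.

Definition tail_mx : 'M[{poly R}]_(#|D|, #|arcs D|) :=
  \matrix_(i, k) ((chiA (enum_val k))%:P *+ (tail (enum_val k) == enum_val i)).

Definition vertex_diag : 'rV[{poly R}]_#|D| :=
  \row_i ('X + (out_weight chiA (enum_val i))%:P).

Definition arc_diag : 'rV[{poly R}]_#|arcs D| :=
  \row_k ('X + (W (head (enum_val k)))%:P).

Definition head_weight_mx : 'M[{poly R}]_(#|arcs D|, #|D|) :=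
  \matrix_(k, i)
    ((chi (inl (enum_val i)))%:P *+ (head (enum_val k) == enum_val i)).

Lemma head_tail_mxE k l : (head_mx *m tail_mx) k l =
  (chiA (enum_val l))%:P *+ (head (enum_val k) == tail (enum_val l)).
Proof.
rewrite mxE (bigD1 (enum_rank (head (enum_val k)))) //= !mxE enum_rankK eqxx.
rewrite mul1r eq_sym big1 ?addr0 // => i ni; rewrite mxE.
case: eqP => [hk|]; last by rewrite mul0r.
by rewrite hk enum_valK eqxx in ni.
Qed.

Lemma laplacian_tail_head :
  laplacian (polyC \o chiA) 'X enum_val =
  diag_mx vertex_diag - tail_mx *m head_mx.
Proof.
apply/matrixP => i j; rewrite !mxE; congr (_ *+ _ - _).
  by rewrite rmorph_sum.
rewrite [RHS](reindex enum_rank) /=; last first.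
  by apply: onW_bij; exists enum_val; [apply: enum_rankK | apply: enum_valK].
rewrite big_mkcond; apply: eq_bigr => e _; rewrite !mxE enum_rankK.
by case: eqP => _; case: eqP => _; rewrite ?mulr1 ?mulr0 ?mul0r.
Qed.

Lemma laplacian_middle :
  laplacian (polyC \o (chi \o @head (middle_digraph D))) 'X sum_enum =
  block_mx (diag_mx vertex_diag) (- tail_mx)
    (- head_weight_mx) (diag_mx arc_diag - head_mx *m tail_mx).
Proof.
have between (x y : middle_digraph D) :=
  @sum_arc_between _ (middle_digraph D) x y (polyC \o chi).
have out (x : middle_digraph D) : \sum_(a | tail a == x)
    (polyC \o (chi \o @head (middle_digraph D))) a =
    (\sum_(y | @middle_arc D x y) chi y)%:P.
  rewrite rmorph_sum -[RHS]/(\sum_(y | _) (polyC \o chi) y).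
  have := @sum_arcs_tail _ (middle_digraph D) x predT (polyC \o chi).
  under eq_bigl => a do rewrite andbT.
  by move=> ->; apply: eq_bigl => y; rewrite andbT.
apply/matrixP => i j; rewrite mxE out between /sum_enum.
case: (split_ordP i) => i' ->; case: (split_ordP j) => j' ->.
all: rewrite ?block_mxEul ?block_mxEur ?block_mxEdl ?block_mxEdr.
all: rewrite ?(eq_lshift, eq_rshift, eq_lrshift, eq_rlshift).
all: rewrite big_sumType /=.
- rewrite big_pred0_eq add0r subr0 !mxE.
  by congr (('X + _%:P) *+ _); apply: eq_bigl => e.
- by rewrite !mxE mulr0n sub0r; case: eqP.
- by rewrite !mxE mulr0n sub0r; case: eqP.
rewrite mxE [X in _ = _ + X]mxE head_tail_mxE !mxE.
congr (('X + _%:P) *+ _ - _); last by case: eqP.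
by rewrite (big_pred1 (head (enum_val i'))) //; congr (_ + _);
  apply: eq_bigl => e; rewrite eq_sym.
Qed.

(** At an arc with head v_i, the diagonal entry splits as chi_i + (x + d_i). This makes the lower
    left block of the conjugated product equal to [head_mx] times the Laplacian of [D]. *)
Lemma arc_diag_head :
  diag_mx arc_diag *m head_mx = head_weight_mx + head_mx *m diag_mx vertex_diag.
Proof.
apply/matrixP => k i; rewrite mul_diag_mx mul_mx_diag !mxE.
case: eqP => [->|_]; last by rewrite mulr0 mul0r mulr0n addr0.
by rewrite mulr1 mul1r mulr1n polyCD addrCA.
Qed.

(* The unipotent matrix [1, 0; H, 1] conjugates the Laplacian of the middle   *)
(* digraph to a block triangular one.                                         *)
Lemma det_laplacian_middle :
  \det (laplacian (polyC \o (chi \o @head (middle_digraph D))) 'X sum_enum) =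
  \det (laplacian (polyC \o chiA) 'X (enum_val : 'I_#|D| -> D)) *
  \prod_(e : arcs D) ('X + (W (head e))%:P).
Proof.
set LM := laplacian _ _ sum_enum; set L := laplacian _ _ _.
pose P := block_mx 1%:M 0 head_mx 1%:M.
pose B := block_mx L (- tail_mx) 0 (diag_mx arc_diag).
have detP : \det P = 1 by rewrite det_lblock !det1 mulr1.
have conj : LM *m P = P *m B.
  rewrite /LM laplacian_middle !mulmx_block.
  rewrite !(mulmx1, mul1mx, mulmx0, mul0mx, addr0, add0r).
  rewrite /L laplacian_tail_head mulNmx; congr block_mx.
    rewrite mulmxBl arc_diag_head mulmxBr mulmxA.
    by rewrite addrA addKr.
  by rewrite mulmxN addrC.
have : \det (LM *m P) = \det (P *m B) by rewrite conj.
rewrite !det_mulmx detP mulr1 mul1r => ->; rewrite det_ublock det_diag.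
congr (_ * _).
rewrite [RHS](reindex (enum_val : 'I_#|arcs D| -> arcs D)) /=; last first.
  by apply: onW_bij; exists enum_rank; [apply: enum_valK | apply: enum_rankK].
by apply: eq_bigr => k _; rewrite mxE.
Qed.

End Middle.

Theorem theorem5 (R : realFieldType) (D : digraph) (connD : connected D)
    (chi : D + arcs D -> R) (chi_gt0 : forall x, 0 < chi x) :
  @kappa_vertex R (middle_digraph D) chi =
  kappa_edge (fun e : arcs D => chi (inr e)) *
  \prod_(v : D) (chi (inl v) + out_weight (fun e : arcs D => chi (inr e)) v)
                  ^+ indeg v.
Proof.
pose W v := chi (inl v) + out_weight (fun e : arcs D => chi (inr e)) v.
have bV : bijective (enum_val : 'I_#|D| -> D).
  by exists enum_rank; [apply: enum_valK | apply: enum_rankK].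
rewrite -[LHS]/(kappa_edge (chi \o @head (middle_digraph D))).
rewrite (kappa_edge_coef _ (sum_enum_bij D)) det_laplacian_middle.
(* The coefficient of x in the product has two terms; the one with the constant coefficient of the
   first factor must vanish. *)
rewrite (kappa_edge_coef _ bV) coefM big_ord_recl big_ord1 /=.
have -> : \prod_v W v ^+ indeg v =
    (\prod_(e : arcs D) ('X + (W (head e))%:P))`_0.
  rewrite -horner_coef0 horner_prod.
  under [RHS]eq_bigr => e _ do rewrite !hornerE.
  rewrite (partition_big (@head D) predT) //=; apply: eq_bigr => v _.
  rewrite /indeg -prodr_const; apply: eq_big => [e|e]; first by rewrite inE.
  by rewrite inE => /eqP->.
rewrite [X in X + _](_ : _ = 0) ?add0r //.
case: (pickP (mem D)) => [v _ | D0].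
  by rewrite (coef0_det_laplacian _ v bV) mul0r.
(* Without vertices there are no arcs, so the second factor is the constant 1. *)
by rewrite big1 ?coef1 ?mulr0 // => e; have := D0 (head e).
Qed.
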